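(* For each compactum (compact Hausdorff space) $X$, the map $\beta^\cdot_{A^\cdot X}:A^\cdot(A^\cdot X)\to A^\cdot X$ is open.
   Context: $C(X,[0,1])$ is the set of continuous functions $X\to[0,1]$ on a compactum $X$, $\vee$ is the pointwise maximum, $c_X$ the constant function with value $c$. $\cdot$-measures: $A^\cdot X=A^\cdot(X)$ is the set of functionals $\mu:C(X,[0,1])\to[0,1]$ with $\mu(1_X)=1$, $\mu(\lambda_X\cdot\varphi)=\lambda\cdot\mu(\varphi)$ for $\lambda\in[0,1]$, $\varphi\in C(X,[0,1])$, and $\mu(\psi\vee\varphi)=\mu(\psi)\vee\mu(\varphi)$ for $\psi,\varphi\in C(X,[0,1])$; it is topologized as a subspace of $[0,1]^{C(X,[0,1])}$ (product topology). A subset $K\subset[0,1]^T$ is max-$\cdot$ convex if $\lambda\cdot a\vee b\in K$ for all $a,b\in K$, $\lambda\in[0,1]$ (coordinatewise operations, $\cdot$ having priority over $\vee$). It is known that $A^\cdot X$ is a compact max-$\cdot$ convex subset of $[0,1]^{C(X,[0,1])}$. Barycenter map: for a compact max-$\cdot$ convex $K\subset[0,1]^T$, $\beta^\cdot_K:A^\cdot(K)\to K$ is defined by letting the $t$-th coordinate of $\beta^\cdot_K(\mu)$ be $\mu(\mathrm{pr}_t|_K)$, where $\mathrm{pr}_t:[0,1]^T\to[0,1]$ is the $t$-th projection. (It is known that $\beta^\cdot_K$ is a well-defined continuous map into $K$.) In the claim, $K=A^\cdot X$ and $T=C(X,[0,1])$. *)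

(* Defs.v *)
From HB Require Import structures.
From mathcomp Require Import all_boot all_order all_algebra.
From mathcomp Require Import all_classical all_reals topology normedtype.

Set Implicit Arguments.
Unset Strict Implicit.
Unset Printing Implicit Defensive.

Import Order.TTheory GRing.Theory Num.Theory.
Import numFieldNormedType.Exports.

Local Open Scope classical_set_scope.
Local Open Scope ring_scope.

(* All subspaces, [0,1] included, are [set_type]s, which carry the initial
   topology of the inclusion. *)
Notation I01 R := (set_type (`[0, 1]%classic : set R)).

(* C(X,[0,1]), used only as a set (it indexes the product [0,1]^C(X,[0,1])). *)
Notation CI R X := (continuousType X (I01 R)).

Section unit_interval.
Variable R : realType.
Implicit Types a b : I01 R.

Lemma I01_ge0 a : 0 <= \val a.
Proof. by have := set_valP a; rewrite /= in_itv /= => /andP[]. Qed.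

Lemma I01_le1 a : \val a <= 1.
Proof. by have := set_valP a; rewrite /= in_itv /= => /andP[]. Qed.

Lemma one_subproof : 1 \in (`[0, 1]%classic : set R).
Proof. by apply/mem_set; rewrite /= in_itv /= ler01 lexx. Qed.

Definition one01 : I01 R := SigSub one_subproof.

Lemma mul_subproof a b : \val a * \val b \in (`[0, 1]%classic : set R).
Proof.
by apply/mem_set; rewrite /= in_itv /= mulr_ge0 ?I01_ge0// mulr_ile1 ?I01_ge0 ?I01_le1.
Qed.

Definition mul01 a b : I01 R := SigSub (mul_subproof a b).

Lemma max_subproof a b : Num.max (\val a) (\val b) \in (`[0, 1]%classic : set R).
Proof.
by apply/mem_set; rewrite /= in_itv /= le_max ge_max I01_ge0 !I01_le1.
Qed.

Definition max01 a b : I01 R := SigSub (max_subproof a b).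

End unit_interval.

Section continuous_functions.
Variables (R : realType) (X : topologicalType).
Implicit Types f g : CI R X.

Lemma continuous_to_sub (Y : topologicalType) (A : set Y) (h : X -> A) :
  continuous (fun x => \val (h x)) -> continuous h.
Proof. by move=> ch; apply: continuous_comp_initial. Qed.

Lemma continuous_val01 f : continuous (fun x => \val (f x) : R).
Proof.
move=> x; apply: (@continuous_comp _ _ _ f (set_val : I01 R -> R)).
  exact: cts_fun.
exact: initial_continuous.
Qed.

Lemma continuous_mul01 f g : continuous (fun x => mul01 (f x) (g x)).
Proof.
apply: continuous_to_sub => x /=.
by apply: (@continuousM R _ (fun x => \val (f x) : R) (fun x => \val (g x) : R)); exact: continuous_val01.
Qed.

Lemma continuous_max01 f g : continuous (fun x => max01 (f x) (g x)).
Proof.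
apply: continuous_to_sub => x /=.
by apply: (@continuous_max R _ (fun x => \val (f x) : R) (fun x => \val (g x) : R)); exact: continuous_val01.
Qed.

Definition cmul f g : CI R X := mkcts (continuous_mul01 (f := f) (g := g)).

Definition cmax f g : CI R X := mkcts (continuous_max01 (f := f) (g := g)).

Definition ccst (c : I01 R) : CI R X := cst c.

End continuous_functions.

(* [{ptws CI R X -> I01 R}] is [0,1]^C(X,[0,1]) with the product topology. *)
Definition dot_measures (R : realType) (X : topologicalType) :
    set {ptws CI R X -> I01 R} :=
  [set mu | [/\ mu (ccst X (one01 R)) = one01 R,
      forall (l : I01 R) (f : CI R X),
        mu (cmul (ccst X l) f) = mul01 l (mu f) &
      forall f g : CI R X, mu (cmax f g) = max01 (mu f) (mu g)]].

Definition A_dot (R : realType) (X : topologicalType) : topologicalType :=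
  set_type (@dot_measures R X).

Section barycenter.
Variables (R : realType) (T : Type) (K : set {ptws T -> I01 R}).

Lemma continuous_pr (t : T) : continuous (fun k : K => (\val k : T -> I01 R) t).
Proof.
move=> k; apply: (@continuous_comp _ _ _ (set_val : K -> {ptws T -> I01 R})
  (fun f : {ptws T -> I01 R} => f t)); first exact: initial_continuous.
set f := set_val k.
have /cvg_sup /(_ t) ft : (nbhs f : set_system {ptws T -> I01 R}) --> f.
  exact: cvg_id.
move=> V fV; apply: ft.
exact: (@initial_continuous _ _ (fun f : {ptws T -> I01 R} => f t) f V fV).
Qed.

Definition pr (t : T) : CI R K := mkcts (continuous_pr (t := t)).

(* For compact max-dot convex K the values lie in K; the corestriction is made
   below, in the case K = A_dot R X, where no assumption is needed. *)
Definition barycenter_fun (mu : A_dot R K) : {ptws T -> I01 R} :=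
  fun t => \val mu (pr t).

End barycenter.

Section barycenter_A.
Variables (R : realType) (X : topologicalType).

Lemma barycenter_fun_in (mu : A_dot R (A_dot R X)) :
  barycenter_fun mu \in @dot_measures R X.
Proof.
have [mu1 mulM mumax] := set_valP mu; apply/mem_set; split.
- apply: etrans (congr1 (\val mu) _) mu1; apply/continuousEP => nu.
  by case: (set_valP nu) => nu1 _ _; exact: nu1.
- move=> l f; apply: etrans (congr1 (\val mu) _) (mulM l (pr _ f)).
  by apply/continuousEP => nu; case: (set_valP nu) => _ nuM _; exact: nuM.
- move=> f g; apply: etrans (congr1 (\val mu) _) (mumax (pr _ f) (pr _ g)).
  by apply/continuousEP => nu; case: (set_valP nu) => _ _ numax; exact: numax.
Qed.

Definition barycenter (mu : A_dot R (A_dot R X)) : A_dot R X :=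
  SigSub (barycenter_fun_in mu).

End barycenter_A.

(* Main.v *)
(* Let M be a .-measure on A = A^.(X), with barycenter m, and let F range over
   finitely many test functions on A. By compactness of A, each F is controlled by
   finitely many coordinates f in C(X,[0,1]). Finitely many functions Phi_j with
   pointwise maximum 1 and small oscillation of these coordinates on their supports
   split m as the maximum of the functionals nu_j(f) = M(Phi_j pr_f); similar
   functions on X yield h_j with maximum 1, m(h_j) = M(Phi_j), and m(h_j f) close to
   nu_j(f). If n is close to m, let kappa'_j be the normalization of f |-> n(h_j f);
   the finitely supported .-measure N(F) = max_j n(h_j) F(kappa'_j) has barycenter
   exactly n because max_j h_j = 1, and N(F) is close to M(F). *)
Require Import Defs.
From mathcomp Require Import all_boot all_order all_algebra.
From mathcomp Require Import all_classical all_reals topology normedtype.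
From mathcomp Require Import ring lra.

Set Implicit Arguments.
Unset Strict Implicit.
Unset Printing Implicit Defensive.

Import Order.TTheory GRing.Theory Num.Theory.
Import numFieldNormedType.Exports.

Local Open Scope classical_set_scope.
Local Open Scope ring_scope.

(** * Compactness and neighbourhoods in subspaces of the cube *)

Lemma compact_set_type (T : topologicalType) (A : set T) :
  compact A -> compact [set: A].
Proof.
move=> cA F FF _; have valA : (set_val @ F) A.
  by apply: (@filterS _ F _ setT); [move=> x _; exact: set_valP|exact: filterT].
have [p [Ap clp]] := cA _ _ valA.
exists (SigSub (mem_set Ap)); split => // U V FU [_ [[W oW <-] /= Wp] WV].
have FUval : (set_val @ F) (set_val @` U).
  by apply: (@filterS _ F _ U) => // x Ux; exists x.
have [_ [[y Uy <-] Wy]] := clp _ _ FUval (open_nbhs_nbhs (conj oW Wp)).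
by exists y; split => //; exact: WV.
Qed.

Lemma compact_I01 (R : realType) : compact [set: I01 R].
Proof. by apply: compact_set_type; exact: segment_compact. Qed.

Lemma closed_eqfun (R : realType) (T : topologicalType) (u v : T -> R) :
  continuous u -> continuous v -> closed [set x | u x = v x].
Proof.
move=> cu cv.
have -> : [set x | u x = v x] = (fun x => u x - v x) @^-1` [set y : R | y = 0].
  by apply/seteqP; split => x /= => [->|/eqP]; rewrite ?subrr// subr_eq0 => /eqP.
apply: preimage_closed; last exact: closed_eq.
by move=> x _; apply: continuousB; [exact: cu|exact: cv].
Qed.

Lemma continuous_valI01 (R : realType) : continuous (\val : I01 R -> R).
Proof. exact: initial_continuous. Qed.

Lemma continuous_eval_val (R : realType) (T : choiceType) (t : T) :
  continuous (fun k : {ptws T -> I01 R} => \val (k t) : R).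
Proof.
move=> k; apply: (@continuous_comp _ _ _ (fun k : {ptws T -> I01 R} => k t)).
  exact: (@proj_continuous T (fun=> I01 R : topologicalType) t).
exact: continuous_valI01.
Qed.

Lemma compact_cube (R : realType) (T : choiceType) :
  compact [set: {ptws T -> I01 R}].
Proof.
have -> : [set: {ptws T -> I01 R}] = [set k | forall t, [set: I01 R] (k t)].
  by apply/seteqP; split.
exact: (@tychonoff T (fun=> I01 R : topologicalType) (fun=> setT)
  (fun=> @compact_I01 R)).
Qed.

(** The defining identities equate continuous functions of finitely many coordinates, so they cut a
    closed set out of the Tychonoff cube. *)
Lemma compact_A_dot (R : realType) (X : topologicalType) : compact [set: A_dot R X].
Proof.
apply: compact_set_type.
have cev := @continuous_eval_val R (CI R X).
apply: subclosed_compact (@compact_cube R (CI R X)) _ => //.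
have -> : @dot_measures R X =
  [set mu | \val (mu (ccst X (one01 R))) = \val (one01 R)] `&`
  ((\bigcap_(lf in [set: I01 R * CI R X])
     [set mu | \val (mu (cmul (ccst X lf.1) lf.2)) = \val lf.1 * \val (mu lf.2)]) `&`
   \bigcap_(fg in [set: CI R X * CI R X])
     [set mu | \val (mu (cmax fg.1 fg.2)) = Num.max (\val (mu fg.1)) (\val (mu fg.2))]).
  apply/seteqP; split => mu.
    by case=> mu1 muM mumax; split=> [/=|]; [rewrite mu1|split=> [[]|[]] f g _ /=;
      rewrite ?muM ?mumax].
  case=> mu1 [muM mumax]; split => [|l f|f g]; apply: val_inj => //.
    exact: (muM (l, f)).
  exact: (mumax (f, g)).
apply: closedI; first by apply: closed_eqfun; [exact: cev|exact: cst_continuous].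
apply: closedI; apply: closed_bigI => -[f g] _; apply: closed_eqfun => //; try exact: cev.
- move=> mu; apply: (@continuousM R _ (fun=> \val f)
    (fun mu : {ptws CI R X -> I01 R} => \val (mu g))).
    exact: cst_continuous.
  exact: cev.
- move=> mu; apply: (@continuous_max R _
    (fun mu : {ptws CI R X -> I01 R} => \val (mu f))
    (fun mu : {ptws CI R X -> I01 R} => \val (mu g))); exact: cev.
Qed.

(* The basic entourage of the pointwise uniformity on [K] given by the finitely
   many coordinates in [i.1] and the radius [i.2]. *)
Definition coord_close (R : realType) (T : choiceType) (K : set {ptws T -> I01 R})
    (i : seq T * R) (k l : K) :=
  forall t, t \in i.1 -> `|\val (\val k t) - \val (\val l t)| < i.2.

(** The sets [coord_close i k] generate a filter, which converges to [k] because it does so in each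
    coordinate of the product. *)
Lemma nbhs_coord_close (R : realType) (T : choiceType) (K : set {ptws T -> I01 R})
    (k : K) (U : set K) :
  nbhs k U -> exists2 i, 0 < i.2 & forall l, coord_close i k l -> U l.
Proof.
pose F := filter_from [set i : seq T * R | 0 < i.2]
  (fun i => [set l : K | coord_close i k l]).
suff /[apply] : F --> k by case=> i i0 iU; exists i.
have FF : Filter F.
  apply: filter_from_filter; first by exists ([::], 1) => /=.
  move=> i j i0 j0; exists (i.1 ++ j.1, Num.min i.2 j.2) => [/=|l kl].
    by rewrite lt_min i0 j0.
  by split=> t ti; have := kl t; rewrite mem_cat ti ?orbT => /(_ isT)/=;
    rewrite lt_min => /andP[].
move=> V [_ [[W oW <-] /= Wk] WV].
suff vF : (set_val @ F : set_system {ptws T -> I01 R}) --> (\val k : {ptws T -> I01 R}).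
  by apply: filterS WV _; exact: vF (open_nbhs_nbhs (conj oW Wk)).
apply/cvg_sup => t A [_ [[B oB <-] /= Bk] BA].
have [_ [[C oC <-] /= Ck CB]] : nbhs (\val k t) B by exact: open_nbhs_nbhs.
have /nbhs_ballP[e /= e0 eC] : nbhs (\val (\val k t) : R) C by exact: open_nbhs_nbhs.
exists ([:: t], e) => //= l kl; apply/BA/CB/eC.
by apply: kl; rewrite mem_head.
Qed.

(** * Finite maxima in the unit interval *)

Lemma I01_ex (R : realType) (r : R) : 0 <= r <= 1 -> exists a : I01 R, \val a = r.
Proof.
move=> r01; have r01' : r \in (`[0, 1]%classic : set R).
  by apply/mem_set; rewrite /= in_itv.
by exists (SigSub r01').
Qed.

Lemma zero_subproof (R : realType) : 0 \in (`[0, 1]%classic : set R).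
Proof. by apply/mem_set; rewrite /= in_itv /= lexx ler01. Qed.

Definition zero01 (R : realType) : I01 R := SigSub (zero_subproof R).

Definition sup01 (R : realType) (I : finType) (u : I -> I01 R) : I01 R :=
  \big[@max01 R/zero01 R]_i u i.

Lemma val_sup01 (R : realType) (I : finType) (u : I -> I01 R) :
  \val (sup01 u) = \big[Num.max/0]_i \val (u i).
Proof. exact: (big_morph (\val : I01 R -> R)). Qed.

Lemma sup01_ub (R : realType) (I : finType) (u : I -> I01 R) i :
  \val (u i) <= \val (sup01 u).
Proof. by rewrite val_sup01; exact: le_bigmax. Qed.

Lemma sup01_le (R : realType) (I : finType) (u : I -> I01 R) (r : R) :
  0 <= r -> (forall i, \val (u i) <= r) -> \val (sup01 u) <= r.
Proof. by move=> r0 ur; rewrite val_sup01; apply: bigmax_le. Qed.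

Lemma sup01_attained (R : realType) (I : finType) (u : I -> I01 R) :
  I -> exists i, sup01 u = u i.
Proof.
move=> i0; have [//|i _|i _] :=
  @eq_bigmax _ _ _ 0 i0 predT (fun i => \val (u i) : R); first exact: I01_ge0.
by rewrite -val_sup01 => /val_inj; exists i.
Qed.

Lemma sup01_dist (R : realType) (I : finType) (u v : I -> I01 R) (e : R) :
  0 <= e -> (forall i, `|\val (u i) - \val (v i)| <= e) ->
  `|\val (sup01 u) - \val (sup01 v)| <= e.
Proof.
move=> e0 uv; rewrite ler_distlC; apply/andP; split.
  rewrite lerBlDr; apply: sup01_le => [|i]; first by rewrite addr_ge0// I01_ge0.
  by move: (uv i) (sup01_ub v i) => /[!ler_distlC]/andP[]; lra.
apply: sup01_le => [|i]; first by rewrite addr_ge0// I01_ge0.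
by move: (uv i) (sup01_ub u i) => /[!ler_distlC]/andP[]; lra.
Qed.

(** * Max-dot functionals, not necessarily normalized *)

Section maxdot.
Variables (R : realType) (X : topologicalType).
Implicit Types (f g : CI R X) (mu : CI R X -> I01 R).

(** Normalization is left out so that the notion also covers the pieces [f |-> mu (cmul h f)] of a
    measure. *)
Definition maxdot mu :=
  (forall l f, mu (cmul (ccst X l) f) = mul01 l (mu f)) /\
  (forall f g, mu (cmax f g) = max01 (mu f) (mu g)).

Definition csup (I : finType) (phi : I -> CI R X) : CI R X :=
  \big[@cmax R X/ccst X (zero01 R)]_i phi i.

Lemma csupE (I : finType) (phi : I -> CI R X) x :
  csup phi x = sup01 (fun i => phi i x).
Proof. exact: (big_morph (fun f => f x)). Qed.

Lemma cmul_csupl (I : finType) (phi : I -> CI R X) f :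
  cmul (csup phi) f = csup (fun i => cmul (phi i) f).
Proof.
apply: (big_morph (fun g => cmul g f)) => [g h|]; apply/continuousEP => x;
  apply: val_inj; rewrite /= ?mul0r//.
by rewrite maxr_pMl// I01_ge0.
Qed.

Lemma cmul_cstl f g l : cmul (cmul (ccst X l) f) g = cmul (ccst X l) (cmul f g).
Proof. by apply/continuousEP => x; apply: val_inj; rewrite /= mulrA. Qed.

Lemma cmul_cst1 f : cmul (ccst X (one01 R)) f = f.
Proof. by apply/continuousEP => x; apply: val_inj; rewrite /= mul1r. Qed.

Lemma cmulf1 f : cmul f (ccst X (one01 R)) = f.
Proof. by apply/continuousEP => x; apply: val_inj; rewrite /= mulr1. Qed.

Variable mu : CI R X -> I01 R.
Hypothesis mu_maxdot : maxdot mu.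

Lemma maxdot_csup (I : finType) (phi : I -> CI R X) :
  mu (csup phi) = sup01 (fun i => mu (phi i)).
Proof.
have [muM mumax] := mu_maxdot; apply: (big_morph mu) => //.
have -> : ccst X (zero01 R) = cmul (ccst X (zero01 R)) (ccst X (zero01 R)).
  by apply/continuousEP => x; apply: val_inj; rewrite /= mul0r.
by rewrite muM; apply: val_inj; rewrite /= mul0r.
Qed.

Lemma maxdot_le f g :
  (forall x, \val (f x) <= \val (g x)) -> \val (mu f) <= \val (mu g).
Proof.
move=> fg; have -> : g = cmax f g.
  by apply/continuousEP => x; apply: val_inj; apply/esym/max_idPr.
by have [_ ->] := mu_maxdot; rewrite /= le_max lexx.
Qed.

Lemma maxdot_cmul_le f g : \val (mu (cmul f g)) <= \val (mu f).
Proof. by apply: maxdot_le => x; rewrite /= ler_piMr ?I01_ge0 ?I01_le1. Qed.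

(** If [f] vanished everywhere, then [f <= 0 * f], and monotonicity with homogeneity would give
    [mu f <= 0]. *)
Lemma maxdot_support f : 0 < \val (mu f) -> exists x, 0 < \val (f x).
Proof.
have [muM _] := mu_maxdot => muf; apply: contrapT => /forallNP fx.
move: muf; apply/negP; rewrite -leNgt -[leRHS](mul0r (\val (mu f))).
have := congr1 \val (muM (zero01 R) f); rewrite /= => <-.
by apply: maxdot_le => x; rewrite /= mul0r leNgt; exact/negP/fx.
Qed.

(** Since [(c - e) f <= f g <= (c + e) f], monotonicity and homogeneity apply. The error is
    proportional to [mu f], so it survives division by this mass. *)
Lemma maxdot_osc f g (c : I01 R) (e : R) :
  (forall x, 0 < \val (f x) -> `|\val (g x) - \val c| <= e) ->
  `|\val (mu (cmul f g)) - \val c * \val (mu f)| <= e * \val (mu f).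
Proof.
move=> gc; have [muM _] := mu_maxdot.
have muf0 := I01_ge0 (mu f); have muf1 := I01_le1 (mu f).
have le_l (l : I01 R) (H : forall x, 0 < \val (f x) -> \val l <= \val (g x)) :
    \val l * \val (mu f) <= \val (mu (cmul f g)).
  have := congr1 \val (muM l f); rewrite /= => <-; apply: maxdot_le => x /=.
  have [fx|fx] := ltP 0 (\val (f x)); first by rewrite mulrC ler_wpM2l ?I01_ge0 ?H.
  have -> : \val (f x) = 0 by apply/eqP; rewrite eq_le fx I01_ge0.
  by rewrite mulr0 mul0r.
have le_u (l : I01 R) (H : forall x, 0 < \val (f x) -> \val (g x) <= \val l) :
    \val (mu (cmul f g)) <= \val l * \val (mu f).
  have := congr1 \val (muM l f); rewrite /= => <-; apply: maxdot_le => x /=.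
  have [fx|fx] := ltP 0 (\val (f x)); first by rewrite [leRHS]mulrC ler_wpM2l ?I01_ge0 ?H.
  have -> : \val (f x) = 0 by apply/eqP; rewrite eq_le fx I01_ge0.
  by rewrite mulr0 mul0r.
have [muf_eq0|muf_neq0] := eqVneq (\val (mu f)) 0.
  have := maxdot_cmul_le f g; rewrite muf_eq0 => mufg.
  have -> : \val (mu (cmul f g)) = 0 by apply/eqP; rewrite eq_le mufg I01_ge0.
  by rewrite !mulr0 subr0 normr0.
(* A point of the support forces [e >= 0]; with zero mass, treated above, [e] could be negative. *)
have [|x fx] := maxdot_support (f := f); first by rewrite lt_neqAle eq_sym muf_neq0.
have e0 : 0 <= e by apply: le_trans (gc x fx).
rewrite ler_distl -mulrBl -mulrDl; apply/andP; split.
  (* Homogeneity holds only for scalars in [[0,1]]; when [c - e] or [c + e] leaves this interval,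
     the corresponding bound is trivial. *)
  have [ce|ce] := leP (\val c - e) 0; first by apply: le_trans (I01_ge0 _); nra.
  have [|l le] := I01_ex (r := \val c - e); first by have := I01_le1 c; lra.
  by rewrite -le; apply: le_l => y /gc; rewrite le ler_distl => /andP[].
have [ce|ce] := leP 1 (\val c + e); first by apply: le_trans (maxdot_cmul_le _ _) _; nra.
have [|l le] := I01_ex (r := \val c + e); first by have := I01_ge0 c; lra.
by rewrite -le; apply: le_u => y /gc; rewrite le ler_distl => /andP[].
Qed.

End maxdot.

(** * Max-partitions of unity subordinate to finitely many functions *)

Section partitions.
Variables (R : realType) (X : topologicalType).
Implicit Types f : CI R X.

Definition max_partition (I : finType) (phi : I -> CI R X) :=
  forall x, exists i, phi i x = one01 R.

Lemma csup_partition (I : finType) (phi : I -> CI R X) :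
  max_partition phi -> csup phi = ccst X (one01 R).
Proof.
move=> phi1; apply/continuousEP => x; apply: val_inj; apply/le_anti.
rewrite I01_le1 csupE; have [i <-] := phi1 x; exact: (sup01_ub (fun i => phi i x)).
Qed.

Definition small_osc f (phi : CI R X) (e : R) :=
  forall x y, 0 < \val (phi x) -> 0 < \val (phi y) ->
    `|\val (f x) - \val (f y)| <= e.

Lemma small_osc_center f phi e : small_osc f phi e ->
  exists c : I01 R, forall x, 0 < \val (phi x) -> `|\val (f x) - \val c| <= e.
Proof.
move=> fphi; have [[y phiy]|phi0] := pselect (exists y, 0 < \val (phi y)).
  by exists (f y) => x phix; exact: fphi.
by exists (one01 R) => x phix; case: phi0; exists x.
Qed.

(** For [d > 0] this is a trapezoid in [f x]: 1 within distance [d] of [k d], and 0 beyond [2 d].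
    The plateau lets some trapezoid be exactly 1 at each point. *)
Lemma tent_subproof f (d : R) (k : nat) x :
  Num.max 0 (Num.min 1 (2 - `|\val (f x) / d - k%:R|)) \in (`[0, 1]%classic : set R).
Proof.
by apply/mem_set; rewrite /= in_itv /= le_max lexx ge_max ler01 ge_min lexx.
Qed.

Definition tent_fun f d k x : I01 R := SigSub (tent_subproof f d k x).

Lemma continuous_tent f d k : continuous (tent_fun f d k).
Proof.
apply: continuous_to_sub => x /=.
apply: (@continuous_max R _ (fun=> 0 : R)
  (fun x => Num.min 1 (2 - `|\val (f x) / d - k%:R|))); first exact: cst_continuous.
apply: (@continuous_min R _ (fun=> 1 : R)
  (fun x => 2 - `|\val (f x) / d - k%:R|)); first exact: cst_continuous.
apply: continuousB; first exact: cst_continuous.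
apply: (@continuous_comp _ _ _ (fun x => \val (f x) / d - k%:R : R) (fun r : R => `|r|)).
  apply: continuousB; last exact: cst_continuous.
  apply: (@continuousM R _ (fun x => \val (f x) : R)); last exact: cst_continuous.
  exact: continuous_val01.
exact: norm_continuous.
Qed.

Definition tent f d k : CI R X := mkcts (continuous_tent (f := f) (d := d) (k := k)).

Lemma small_osc_tent f d k : 0 < d -> small_osc f (tent f d k) (4 * d).
Proof.
move=> d0 x y.
have H z : 0 < \val (tent f d k z) -> `|\val (f z) - k%:R * d| <= 2 * d.
  rewrite /= lt_max ltxx lt_min ltr01 /= subr_gt0 => /ltW.
  have -> : \val (f z) - k%:R * d = (\val (f z) / d - k%:R) * d by field; rewrite gt_eqF.
  by rewrite normrM (gtr0_norm d0) ler_pM2r.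
by move=> /H + /H; rewrite !ler_distl => /andP[? ?] /andP[? ?]; lra.
Qed.

(** The index serving [x] is the integer part of [f x / d], at most that of [1 / d] because
    [f x <= 1]; [x] then lies on the plateau. *)
Lemma tent_partition f (d : R) : 0 < d ->
  max_partition (fun k : 'I_(Num.trunc d^-1).+1 => tent f d k).
Proof.
move=> d0 x; have fd0 : 0 <= \val (f x) / d by rewrite divr_ge0 ?I01_ge0 ?ltW.
have /andP[kl kr] := truncn_itv fd0.
have kn : (Num.trunc (\val (f x) / d) < (Num.trunc d^-1).+1)%N.
  by rewrite ltnS le_truncn// ler_piMl ?I01_le1// invr_ge0 ltW.
have k1 : 1 <= 2 - `|\val (f x) / d - (Num.trunc (\val (f x) / d))%:R|.
  by rewrite ger0_norm ?subr_ge0//; move: kr; rewrite -natr1; lra.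
exists (Ordinal kn); apply: val_inj.
exact: (etrans (congr1 (Num.max 0) (min_l k1)) (max_r ler01)).
Qed.

Lemma max_partition_prod (I J : finType) (phi : I -> CI R X) (psi : J -> CI R X) :
  max_partition phi -> max_partition psi ->
  max_partition (fun ij : I * J => cmul (phi ij.1) (psi ij.2)).
Proof.
move=> phi1 psi1 x; have [[i iE] [j jE]] := (phi1 x, psi1 x).
by exists (i, j); apply: val_inj; rewrite /= iE jE mul1r.
Qed.

Lemma small_osc_cmul f (phi psi : CI R X) e :
  small_osc f phi e \/ small_osc f psi e -> small_osc f (cmul phi psi) e.
Proof.
move=> H x y /= x0 y0.
by case: H; apply; rewrite lt_neqAle I01_ge0 andbT eq_sym; apply/negP => /eqP E;
  move: x0 y0; rewrite E ?(mulr0, mul0r) ltxx.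
Qed.

(** Products of trapezoids, one factor for each function in [s]: the support of a product lies in
    that of each factor. *)
Lemma exists_max_partition (s : seq (CI R X)) (e : R) : 0 < e ->
  exists (I : finType) (phi : I -> CI R X), max_partition phi /\
    forall i f, f \in s -> small_osc f (phi i) e.
Proof.
move=> e0; have [d d0 ->] : exists2 d, 0 < d & e = 4 * d by exists (e / 4); lra.
elim: s => [|f s [I [phi [phi1 phis]]]].
  exists unit, (fun=> ccst X (one01 R)); split=> // x; by exists tt.
exists ('I_(Num.trunc d^-1).+1 * I)%type, (fun ki : 'I__ * I => cmul (tent f d ki.1) (phi ki.2)); split.
  exact: max_partition_prod (tent_partition f d0) phi1.
move=> [k i] g; rewrite in_cons => /orP[/eqP ->|gs]; apply: small_osc_cmul.
  by left; exact: small_osc_tent.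
by right; exact: phis.
Qed.

End partitions.

(** * Conditional measures and approximate densities *)

Lemma val_mul01 (R : realType) (a b : I01 R) : \val (mul01 a b) = \val a * \val b.
Proof. by []. Qed.

(** The second conjunct fixes 0 / 0 as 1, so that equal masses always have ratio 1. *)
Lemma I01_quotient (R : realType) (a b : I01 R) : \val a <= \val b ->
  exists c, a = mul01 c b /\ (a = b -> c = one01 R).
Proof.
move=> ab; have [b0|b0] := eqVneq (\val b) 0.
  exists (one01 R); split=> //; apply: val_inj; rewrite /= mul1r.
  by apply/le_anti; rewrite ab b0 I01_ge0.
have bp : 0 < \val b by rewrite lt_neqAle eq_sym b0 I01_ge0.
have [|c cE] := I01_ex (r := \val a / \val b).
  by rewrite divr_ge0 ?I01_ge0// ler_pdivrMr// mul1r.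
exists c; split=> [|aE]; apply: val_inj; rewrite [LHS]/= ?cE ?aE ?divff//.
by rewrite /= cE divfK.
Qed.

(** Both [a * y] and [z] lie within [e / 2 * p] of [c * p]. *)
Lemma densities_bound (R : realFieldType) (e a c r y z w p : R) :
  0 < e -> 0 <= a -> p = a * r -> p <= w ->
  `|z - c * p| <= e / 2 * p -> `|y - c * r| <= e / 2 * r -> `|a * y - z| <= e * w.
Proof.
move=> e0 a0 -> arw; rewrite !ler_distl => /andP[z1 z2] /andP[y1 y2].
have H1 := ler_wpM2l a0 y1; have H2 := ler_wpM2l a0 y2.
have H3 := ler_wpM2l (ltW e0) arw.
by apply/andP; split; lra.
Qed.

Section decomposition.
Variables (R : realType) (X : topologicalType).
Implicit Types (f g h : CI R X) (mu : A_dot R X).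

Lemma A_dot1 mu : \val mu (ccst X (one01 R)) = one01 R.
Proof. by have [] := set_valP mu. Qed.

Lemma A_dot_maxdot mu : maxdot (\val mu).
Proof. by have [_ muM mumax] := set_valP mu. Qed.

Lemma maxdot_cmul (nu : CI R X -> I01 R) h :
  maxdot nu -> maxdot (fun f => nu (cmul h f)).
Proof.
move=> [nuM numax]; split=> [l f|f g].
  rewrite -nuM; congr nu; apply/continuousEP => x; apply: val_inj => /=.
  by rewrite mulrCA.
rewrite -numax; congr nu; apply/continuousEP => x; apply: val_inj => /=.
by rewrite mulrC maxr_pMl ?I01_ge0// ![_ * \val (h x)]mulrC.
Qed.

(** The measure is [f |-> mu (h f) / mu h]. If [mu h = 0], both sides vanish for any measure, and
    [mu] itself serves. *)
Lemma conditional_measure mu h : exists nu : A_dot R X,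
  forall f, \val mu (cmul h f) = mul01 (\val mu h) (\val nu f).
Proof.
have mumd := A_dot_maxdot mu.
have [muh0|muh0] := eqVneq (\val (\val mu h)) 0.
  exists mu => f; apply: val_inj; rewrite /= muh0 mul0r; apply/le_anti.
  by have := maxdot_cmul_le mumd h f; rewrite muh0 => ->; rewrite I01_ge0.
have muhp : 0 < \val (\val mu h) by rewrite lt_neqAle eq_sym muh0 I01_ge0.
have /choice[nu nuE] f : exists c, \val mu (cmul h f) = mul01 (\val mu h) c.
  have [c [cE _]] := I01_quotient (maxdot_cmul_le mumd h f).
  by exists c; rewrite cE; apply: val_inj; rewrite /= mulrC.
have mulI (a b : I01 R) : mul01 (\val mu h) a = mul01 (\val mu h) b -> a = b.
  by move=> /(congr1 \val) /= /(mulfI muh0)/val_inj.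
have [muM mumax] := maxdot_cmul h mumd.
suff nu_in : (nu : {ptws CI R X -> I01 R}) \in @dot_measures R X by exists (SigSub nu_in).
apply/mem_set; split=> [|l f|f g]; apply: mulI; rewrite -nuE.
- by rewrite cmulf1; apply: val_inj; rewrite /= mulr1.
- by rewrite muM nuE; apply: val_inj; rewrite /= mulrCA.
- rewrite mumax !nuE; apply: val_inj; rewrite /= [RHS]mulrC maxr_pMl ?I01_ge0//.
  by rewrite ![_ * \val (\val mu h)]mulrC.
Qed.

(* A Radon-Nikodym theorem up to [e]: [h j] is a max-partition of unity with small
   oscillation, weighted by the ratios [nu j (psi i) / mu (psi i)] ([1] if [0 / 0]). *)
Lemma exists_densities mu (J : finType) (nu : J -> CI R X -> I01 R)
    (s : seq (CI R X)) (e : R) :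
  (forall j, maxdot (nu j)) -> (forall f, \val mu f = sup01 (nu ^~ f)) -> 0 < e ->
  exists h : J -> CI R X, max_partition h /\ forall j,
    \val mu (h j) = nu j (ccst X (one01 R)) /\
    forall f, f \in s -> `|\val (\val mu (cmul (h j) f)) - \val (nu j f)|
      <= e * \val (\val mu (h j)).
Proof.
move=> numd muE e0; have mumd := A_dot_maxdot mu.
have e20 : 0 < e / 2 by rewrite divr_gt0.
have [I [psi [psi1 psis]]] := exists_max_partition s e20.
have nu_le f j : \val (nu j f) <= \val (\val mu f).
  by rewrite muE; exact: (sup01_ub (nu ^~ f)).
(* An empty [J] would make [mu] of the constant 1 an empty maximum, that is 0. *)
have [j0] : exists j0 : J, True.
  apply: contrapT => /forallNP noJ.
  have /(sup01_le (lexx 0)) : forall j, \val (nu j (ccst X (one01 R))) <= 0.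
    by move=> j; have := noJ j.
  by rewrite -muE A_dot1 /= ler10.
move=> _; have [a aE] := choice (fun ij : I * J =>
  I01_quotient (nu_le (psi ij.1) ij.2)).
pose h j := csup (fun i => cmul (ccst X (a (i, j))) (psi i)).
have muh j f : \val mu (cmul (h j) f) =
    sup01 (fun i => mul01 (a (i, j)) (\val mu (cmul (psi i) f))).
  rewrite cmul_csupl maxdot_csup//; congr sup01; apply/funext => i.
  by rewrite cmul_cstl mumd.1.
have nuE j f : nu j f = sup01 (fun i => nu j (cmul (psi i) f)).
  by rewrite -[f in LHS]cmul_cst1 -(csup_partition psi1) cmul_csupl maxdot_csup.
(* The factors [a] turn each [mu (psi i)] into [nu j (psi i)], so the total masses agree exactly. *)
have muh1 j : \val mu (h j) = nu j (ccst X (one01 R)).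
  rewrite nuE -[h j]cmulf1 muh; congr sup01; apply/funext => i.
  by rewrite !cmulf1 -(aE (i, j)).1.
exists h; split=> [x|j].
  (* Choose [i] with [psi i x = 1], then [j] where the maximum [mu (psi i)] is attained: the ratio
     [a (i, j)] is 1, hence [h j x = 1]. *)
  have [i psi_ix] := psi1 x.
  have [j jE] := sup01_attained (nu ^~ (psi i)) j0.
  exists j; apply: val_inj; apply/le_anti; rewrite I01_le1 csupE.
  apply: le_trans (sup01_ub _ i); rewrite /= psi_ix (aE (i, j)).2 ?mul1r//.
  by rewrite -jE muE.
split=> // f fs; rewrite muh nuE.
apply: sup01_dist => [|i]; first by rewrite mulr_ge0 ?I01_ge0// ltW.
(* On the support of [psi i], [f] is nearly a constant [c], so both terms are close to
   [c * nu j (psi i)]. *)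
have [c fc] := small_osc_center (psis i f fs).
rewrite val_mul01; apply: (densities_bound e0 (I01_ge0 (a (i, j)))
  (r := \val (\val mu (psi i))) (c := \val c) _ _ (maxdot_osc (numd j) fc)
  (maxdot_osc mumd fc)).
  exact: (congr1 (fun b : I01 R => \val b : R) (aE (i, j)).1).
by rewrite muh1; apply: maxdot_le => // x; exact: I01_le1.
Qed.

End decomposition.

(** * Uniform continuity in terms of finitely many coordinates *)

Lemma ltr_dist_half (R : realFieldType) (x y z e : R) :
  `|x - y| < e / 2 -> `|x - z| < e / 2 -> `|y - z| < e.
Proof.
by rewrite !ltr_distl => /andP[? ?] /andP[? ?]; apply/andP; split; lra.
Qed.

Lemma dist_near (R : realType) (X : topologicalType) (f : CI R X) (y : X) (e : R) :
  0 < e -> \forall x \near y, `|\val (f y) - \val (f x)| < e.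
Proof.
exact: (@cvgr_dist_lt R R X (nbhs y) _ (fun x => \val (f x) : R) _
  (@continuous_val01 R X f y)).
Qed.

Lemma near_all_seq (T : choiceType) (Y : Type) (F : set_system Y)
    {FF : Filter F} (P : T -> Y -> Prop) (s : seq T) :
  (forall t, t \in s -> \forall y \near F, P t y) ->
  \forall y \near F, forall t, t \in s -> P t y.
Proof.
elim: s => [|t s IHs] sP; first exact: nearW.
have Ht : \forall y \near F, P t y by apply: sP; rewrite mem_head.
have Hs : \forall y \near F, forall t, t \in s -> P t y.
  by apply: IHs => u us; apply: sP; rewrite in_cons us orbT.
by apply: filterS2 Ht Hs => y Pt Ps u /[!in_cons]/orP[/eqP ->//|/Ps].
Qed.

Section uniform.
Variables (R : realType) (T : choiceType) (K : set {ptws T -> I01 R}).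

Lemma near_coord_close (k : K) (i : seq T * R) : 0 < i.2 -> \forall l \near k, coord_close i k l.
Proof.
move=> i0; apply: (@near_all_seq _ _ (nbhs k) _
  (fun t l => `|\val (\val k t) - \val (\val l t)| < i.2)) => t _.
exact: (dist_near (pr K t) k i0).
Qed.

(** A Heine-Cantor argument: compactness, as a near-covering property, replaces the index found at
    each point by one index for all points. *)
Lemma coord_close_uniform (s : seq (CI R K)) (e : R) : compact [set: K] -> 0 < e ->
  exists2 i, 0 < i.2 & forall k l, coord_close i k l ->
    forall F, F \in s -> `|\val (F k) - \val (F l)| < e.
Proof.
move=> cK e0; have e20 : 0 < e / 2 by lra.
(* [G] is the filter of eventual refinement on indices: its members contain all [j] finer than some
   [i]. *)
pose G := filter_from [set i : seq T * R | 0 < i.2]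
  (fun i => [set j | forall k l : K, coord_close j k l -> coord_close i k l]).
have FG : Filter G.
  apply: filter_from_filter; first by exists ([::], 1) => /=.
  move=> i j i0 j0; exists (i.1 ++ j.1, Num.min i.2 j.2) => [/=|n ijn].
    by rewrite lt_min i0 j0.
  split=> k l /ijn kl t ti; have := kl t; rewrite mem_cat ti ?orbT => /(_ isT)/=;
    by rewrite lt_min => /andP[].
have /compact_near_coveringP/(_ _ G (fun i k => forall l, coord_close i k l ->
    forall F, F \in s -> `|\val (F k) - \val (F l)| < e) FG) := cK.
case=> [k _|i i0 iP]; last by exists i => // k l; apply: iP.
have /nbhs_coord_close[i i0 iP] : \forall l \near k, forall F, F \in s ->
    `|\val (F k) - \val (F l)| < e / 2.
  apply: (@near_all_seq _ _ (nbhs k) _ (fun (F : CI R K) (l : K) => `|\val (F k) - \val (F l)| < e / 2)) => F _.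
  exact: (dist_near F k e20).
(* With half the radius, a point [l] close to a neighbour [k'] of [k] is still within the full
   radius of [k]. *)
have i20 : 0 < i.2 / 2 by lra.
exists ([set l | coord_close (i.1, i.2 / 2) k l],
  [set j | forall k l : K, coord_close j k l -> coord_close (i.1, i.2 / 2) k l]).
  by split; [exact: near_coord_close|exists (i.1, i.2 / 2)].
move=> [k' j] [/= kk' ji] l /ji k'l F Fs.
have kF : `|\val (F k) - \val (F l)| < e / 2.
  apply: iP Fs => t ti; apply: (ltr_dist_half _ (k'l t ti)).
  by rewrite distrC; exact: kk'.
have kF' : `|\val (F k) - \val (F k')| < e / 2.
  apply: iP Fs => t ti; move: (kk' t ti) => /= /lt_trans; apply; lra.
exact: ltr_dist_half kF' kF.
Qed.

End uniform.

(** * Finitely supported measures *)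

Section atoms.
Variables (R : realType) (Y : topologicalType).

Lemma maxdot_sup01 (J : finType) (nu : J -> CI R Y -> I01 R) :
  (forall j, maxdot (nu j)) -> maxdot (fun F => sup01 (nu ^~ F)).
Proof.
move=> numd; split=> [l F|F G].
  have -> : nu ^~ (cmul (ccst Y l) F) = fun j => mul01 l (nu j F).
    by apply/funext => j; rewrite (numd j).1.
  apply/esym/(big_morph (mul01 l)) => [a b|]; apply: val_inj; rewrite /= ?mulr0//.
  by rewrite mulrC maxr_pMl ?I01_ge0// ![_ * \val l]mulrC.
apply: val_inj; apply/le_anti/andP; split.
  apply: sup01_le => [|j]; first exact: I01_ge0.
  rewrite (numd j).2 /= ge_max !le_max.
  by rewrite (sup01_ub (nu ^~ F)) (sup01_ub (nu ^~ G)) orbT.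
rewrite /= ge_max; apply/andP; split; (apply: sup01_le => [|j];
  [exact: I01_ge0|apply: le_trans (sup01_ub _ j)]);
  by rewrite (numd j).2 /= le_max lexx ?orbT.
Qed.

(** Atoms [y j] of mass [a j]: each weighted evaluation is max-dot, finite maxima preserve this, and
    the condition on [a] is the normalization. *)
Lemma sup_dirac (J : finType) (a : J -> I01 R) (y : J -> Y) : sup01 a = one01 R ->
  exists N : A_dot R Y, forall F, \val N F = sup01 (fun j => mul01 (a j) (F (y j))).
Proof.
move=> a1; have [NM Nmax] : maxdot (fun F : CI R Y => sup01 (fun j => mul01 (a j) (F (y j)))).
  apply: maxdot_sup01 => j; split=> [l F|F G]; apply: val_inj => /=.
    by rewrite mulrCA.
  by rewrite mulrC maxr_pMl ?I01_ge0// ![_ * \val (a j)]mulrC.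
have Nin : ((fun F => sup01 (fun j => mul01 (a j) (F (y j)))) :
    {ptws CI R Y -> I01 R}) \in @dot_measures R Y.
  apply/mem_set; split => //; rewrite -[RHS]a1; congr sup01; apply/funext => j.
  by apply: val_inj; rewrite /= mulr1.
by exists (SigSub Nin).
Qed.

End atoms.

(** * Lifting measures near a barycenter *)

(** The condition says that [v / u] is within [d] of [c]; multiplied by [u], it is a strict
    inequality between continuous functions, hence open. *)
Lemma ratio_near (R : realType) (Y : topologicalType) (u v : CI R Y) (y : Y) (c d : R) :
  0 < \val (u y) -> `|\val (v y) - c * \val (u y)| < d * \val (u y) ->
  \forall z \near y, 0 < \val (u z) /\
    `|\val (v z) - c * \val (u z)| < d * \val (u z).
Proof.
move=> uy; rewrite -subr_gt0 => uvy.
have cu : (fun z => \val (u z) : R) @ y --> \val (u y) := @continuous_val01 R Y u y.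
have cv : (fun z => \val (v z) : R) @ y --> \val (v y) := @continuous_val01 R Y v y.
have cuv : (fun z => d * \val (u z) - `|\val (v z) - c * \val (u z)|) @ y -->
    d * \val (u y) - `|\val (v y) - c * \val (u y)|.
  exact: (cvgB (cvgM (cvg_cst d) cu) (cvg_norm (cvgB cv (cvgM (cvg_cst c) cu)))).
have uz : \forall z \near y, 0 < \val (u z) by exact: (cvgr_gt _ cu _ uy).
have uvz : \forall z \near y, 0 < d * \val (u z) - `|\val (v z) - c * \val (u z)|.
  exact: (cvgr_gt _ cuv _ uvy).
by apply: filterS2 uz uvz => z z1 z2; split; rewrite // -subr_gt0.
Qed.

Section lifting.
Variables (R : realType) (X : topologicalType).
Local Notation pr := (pr (@dot_measures R X)).

Lemma barycenterE (M : A_dot R (A_dot R X)) f :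
  \val (barycenter M) f = \val M (pr f).
Proof. by []. Qed.

Lemma pr1 : pr (ccst X (one01 R)) = ccst (A_dot R X) (one01 R).
Proof. by apply/continuousEP => mu; exact: A_dot1. Qed.

Lemma maxdot_pr (N : CI R (A_dot R X) -> I01 R) :
  maxdot N -> maxdot (fun f => N (pr f)).
Proof.
move=> [NM Nmax]; split=> [l f|f g].
  by rewrite -NM; congr N; apply/continuousEP => mu; exact: (A_dot_maxdot mu).1.
by rewrite -Nmax; congr N; apply/continuousEP => mu; exact: (A_dot_maxdot mu).2.
Qed.

(** Two errors of [d / 3] leave slack, which gives the strict inequality that [ratio_near]
    propagates. *)
Lemma ratio_bound (l z x c d : R) : 0 < d -> 0 < l ->
  `|z - c * l| <= d / 3 * l -> `|x - z| <= d / 3 * l -> `|x - c * l| < d * l.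
Proof.
move=> d0 l0; have dl := mulr_gt0 d0 l0.
rewrite !ler_distl ltr_distl => /andP[? ?] /andP[? ?]; apply/andP; split; lra.
Qed.

(** Three errors of [e / 4]: from [x] to [c * l], from [c] to [c'], from [l] to [l']. If [l = 0],
    then [x = 0] and only the last one remains. *)
Lemma atom_bound (x l l' c c' e : R) : 0 < e -> 0 <= x <= l -> l <= 1 ->
  0 <= c' <= 1 -> `|l - l'| < e / 4 ->
  (0 < l -> `|x - c * l| <= e / 4 * l /\ `|c - c'| < e / 4) ->
  `|x - l' * c'| <= 3 / 4 * e.
Proof.
move=> e0 /andP[x0 xl] l1 /andP[c0 c1] ll H.
have -> : x - l' * c' = (x - l * c') + (l - l') * c' by ring.
have H1 : `|(l - l') * c'| <= e / 4.
  by rewrite normrM (ger0_norm c0); apply: le_trans (ltW ll); rewrite ler_piMr.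
suff H2 : `|x - l * c'| <= e / 2 by apply: le_trans (ler_normD _ _) _; lra.
have [l0|l0] := ltP 0 l; last first.
  have [-> ->] : x = 0 /\ l = 0 by split; apply/le_anti; lra.
  by rewrite mul0r subr0 normr0; lra.
have [xc cc] := H l0.
have -> : x - l * c' = (x - c * l) + l * (c - c') by ring.
have H3 : `|l * (c - c')| <= e / 4.
  by rewrite normrM (gtr0_norm l0); apply: le_trans (ltW cc); rewrite ler_piMl.
have H4 : e / 4 * l <= e / 4 by rewrite ler_piMr// divr_ge0// ltW.
by apply: le_trans (ler_normD _ _) _; lra.
Qed.

Lemma lift_near (M : A_dot R (A_dot R X)) (s : seq (CI R (A_dot R X))) (e : R) :
  0 < e -> \forall m \near barycenter M, exists2 N, barycenter N = m &
    coord_close (s, e) M N.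
Proof.
move=> e0; have e40 : 0 < e / 4 by rewrite divr_gt0.
have [q0 qe] : 0 <= 3 / 4 * e /\ 3 / 4 * e < e by split; lra.
have [[t d] /= d0 td] := coord_close_uniform s (@compact_A_dot R X) e40.
(* One [d / 3] bounds the oscillation on the support of [Phi j], another the error of the densities;
   the rest is room for moving from [m] to [n]. *)
have [d30 d3d] : 0 < d / 3 /\ d / 3 < d by split; lra.
have [J [Phi [Phi1 Phit]]] := exists_max_partition [seq pr f | f <- t] d30.
have Mmd := A_dot_maxdot M; set m := barycenter M.
pose nu j f := \val M (cmul (Phi j) (pr f)).
have numd j : maxdot (nu j) := maxdot_pr (maxdot_cmul (Phi j) Mmd).
have ME F : \val M F = sup01 (fun j => \val M (cmul (Phi j) F)).
  by rewrite -[F in LHS]cmul_cst1 -(csup_partition Phi1) cmul_csupl maxdot_csup.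
have mE f : \val m f = sup01 (nu ^~ f) by rewrite barycenterE ME.
have [h [h1 hnu]] := exists_densities t numd mE d30.
have mh j : \val m (h j) = \val M (Phi j) by rewrite (hnu j).1 /nu pr1 cmulf1.
(* [kappa j] is a reference point in the support of [Phi j]; for zero mass nothing is asked of it,
   and [m] is a default. *)
have /choice[kappa kappaE] j : exists k : A_dot R X,
    0 < \val (\val M (Phi j)) -> 0 < \val (Phi j k).
  have [/(maxdot_support Mmd)[k k0]|_] := ltP 0 (\val (\val M (Phi j))).
    by exists k.
  by exists m.
have near_mass : \forall n \near m, forall j, j \in enum J ->
    `|\val (\val m (h j)) - \val (\val n (h j))| < e / 4.
  apply: (@near_all_seq _ _ (nbhs m) _ (fun (j : J) (n : A_dot R X) =>
    `|\val (\val m (h j)) - \val (\val n (h j))| < e / 4)) => j _.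
  exact: (dist_near (pr (h j)) m e40).
(* This places the future atom [n (h j f) / n (h j)] within [d] of [kappa j] in the coordinates
   [t]. *)
have near_ratio : \forall n \near m, forall j, j \in enum J -> forall f, f \in t ->
    0 < \val (\val M (Phi j)) -> 0 < \val (\val n (h j)) /\
    `|\val (\val n (cmul (h j) f)) - \val (\val (kappa j) f) * \val (\val n (h j))|
     < d * \val (\val n (h j)).
  apply: (@near_all_seq _ _ (nbhs m) _ (fun (j : J) (n : A_dot R X) =>
    forall f, f \in t -> 0 < \val (\val M (Phi j)) -> 0 < \val (\val n (h j)) /\
    `|\val (\val n (cmul (h j) f)) - \val (\val (kappa j) f) * \val (\val n (h j))|
     < d * \val (\val n (h j)))) => j _.
  apply: (@near_all_seq _ _ (nbhs m) _ (fun (f : CI R X) (n : A_dot R X) =>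
    0 < \val (\val M (Phi j)) -> 0 < \val (\val n (h j)) /\
    `|\val (\val n (cmul (h j) f)) - \val (\val (kappa j) f) * \val (\val n (h j))|
     < d * \val (\val n (h j)))) => f ft.
  have [Mj|_] := ltP 0 (\val (\val M (Phi j))); last by apply: nearW.
  have mj : 0 < \val (\val m (h j)) by rewrite mh.
  have PhiP k : 0 < \val (Phi j k) -> `|\val (\val k f) - \val (\val (kappa j) f)| <= d / 3.
    by move=> k0; apply: (Phit j _ (map_f _ ft)) => //; exact: kappaE.
  have := maxdot_osc Mmd (g := pr f) PhiP; rewrite -mh => /(ratio_bound d0 mj).
  move=> /(_ _ ((hnu j).2 f ft)) /(@ratio_near R _ (pr (h j)) (pr (cmul (h j) f)) m _ _ mj).
  by apply: filterS => n n12 _.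
apply: filterS2 near_mass near_ratio => n n_mass n_ratio.
have nmd := A_dot_maxdot n.
have /choice[kappa' kappa'E] j := conditional_measure n (h j).
have [|N NE] := @sup_dirac _ _ J (fun j => \val n (h j)) kappa'.
  by rewrite -maxdot_csup// csup_partition// A_dot1.
exists N.
  (* The weight [n (h j)] cancels the normalization of [kappa' j], and [max_j h j = 1] restores
     [n f] exactly. *)
  apply: val_inj; apply/funext => f; rewrite barycenterE NE.
  transitivity (sup01 (fun j => \val n (cmul (h j) f))).
    by congr sup01; apply/funext => j; rewrite kappa'E.
  by rewrite -maxdot_csup// -cmul_csupl csup_partition// cmul_cst1.
move=> F Fs /=.
have -> : \val N F = sup01 (fun j => mul01 (\val n (h j)) (F (kappa' j))) by exact: NE.
(* Both values are maxima over [j], so they are compared atom by atom. *)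
rewrite ME; apply: (le_lt_trans _ qe); apply: sup01_dist => // j.
rewrite val_mul01; apply: (atom_bound (l := \val (\val M (Phi j)))
  (c := \val (F (kappa j)))) => //.
- by rewrite I01_ge0 maxdot_cmul_le.
- exact: I01_le1.
- by rewrite I01_ge0 I01_le1.
- by rewrite -mh; apply: n_mass; rewrite mem_enum.
move=> Mj; split.
  (* On the support of [Phi j] the coordinates [t] differ from those of [kappa j] by at most
     [d / 3 < d], so [F] varies by less than [e / 4]. *)
  apply: maxdot_osc => // k Phik; apply: ltW; apply: td Fs => f ft /=.
  by apply: (le_lt_trans _ d3d); apply: (Phit j (pr f) (map_f _ ft)) => //; exact: kappaE.
apply: td Fs => f ft /=; have [|nhj] := n_ratio j _ f ft Mj; first by rewrite mem_enum.
have -> : \val (\val n (cmul (h j) f)) =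
    \val (\val (kappa' j) f) * \val (\val n (h j)) by rewrite kappa'E val_mul01 mulrC.
by rewrite -mulrBl normrM (gtr0_norm nhj) ltr_pM2r// distrC.
Qed.

End lifting.

Theorem theorem3 (R : realType) (X : topologicalType)
    (Xcompact : compact [set: X]) (Xhausdorff : hausdorff_space X)
    (U : set (A_dot R (A_dot R X))) :
  open U -> open (@barycenter R X @` U).
Proof.
move=> oU; rewrite openE => _ [M UM <-].
have [[s e] /= e0 sU] := nbhs_coord_close (open_nbhs_nbhs (conj oU UM)).
by apply: filterS (lift_near M s e0) => m [N <- MN]; exists N => //; exact: sU.
Qed.
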